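(* Let $p\ge7$ be a prime. Consider the set of all groups $\langle s,w,A\rangle$, where $A$ ranges over the finite subgroups of $\mathrm{D}(p,\mathbb{C})$ that are invariant under conjugation by $\mathrm{Sym}(p)$ and are not contained in the group of scalar matrices. Each such group is a finite irreducible subgroup of $\mathrm{M}(p,\mathbb{C})$ with permutation part $\mathrm{Alt}(p)$; every finite irreducible subgroup of $\mathrm{M}(p,\mathbb{C})$ with permutation part $\mathrm{Alt}(p)$ is $\mathrm{GL}(p,\mathbb{C})$-conjugate to one of them; and no two distinct ones are $\mathrm{GL}(p,\mathbb{C})$-conjugate.
   Context: $\mathrm{M}(p,\mathbb{C})$ is the group of monomial matrices, $\mathrm{D}(p,\mathbb{C})$ the invertible diagonal matrices; permutations $\alpha$ are identified with permutation matrices $[\delta_{i\alpha,j}]_{i,j}$, and $\mathrm{Alt}(p)$ with the even ones. The permutation part of $G\le\mathrm{M}(p,\mathbb{C})$ is its image under $dt\mapsto t$ ($d$ diagonal, $t$ a permutation matrix). $s$ is the permutation matrix of $(1,2,\ldots,p)$ and $w$ that of $(1,2,3)$. *)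

(* Defs.v *)
From mathcomp Require Import all_boot all_algebra all_fingroup.
Set Implicit Arguments. Unset Strict Implicit. Unset Printing Implicit Defensive.
Import GRing.Theory Num.Theory.
Local Open Scope ring_scope.

Section MonomialGroups.
Variables (F : fieldType) (p : nat).

(* Subsets of 'M[F]_p are predicates (the matrix type is infinite). *)
Definition mxset := 'M[F]_p -> Prop.

Definition set_eq (G H : mxset) : Prop := forall g, G g <-> H g.
Definition set_sub (G H : mxset) : Prop := forall g, G g -> H g.

Definition is_subgroup (G : mxset) : Prop :=
  [/\ G 1%:M,
      (forall g, G g -> g \in unitmx),
      (forall g h, G g -> G h -> G (g *m h)) &
      (forall g, G g -> G (invmx g))].

Definition is_finite_set (G : mxset) : Prop :=
  exists l : seq 'M[F]_p, forall g, G g -> g \in l.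

Definition gen_group (S : mxset) : mxset :=
  fun g => forall H, is_subgroup H -> set_sub S H -> H g.

Definition conj_set (X : 'M[F]_p) (G : mxset) : mxset :=
  fun h => exists2 g, G g & h = invmx X *m g *m X.

Definition GL_conjugate (G H : mxset) : Prop :=
  exists2 X : 'M[F]_p, X \in unitmx & set_eq (conj_set X G) H.

Definition is_diag_inv (g : 'M[F]_p) : Prop :=
  exists2 d : 'rV[F]_p, (forall i, d 0 i != 0) & g = diag_mx d.

Definition is_scalar (g : 'M[F]_p) : Prop := exists c : F, g = c%:M.

(* g = d t with d invertible diagonal and t = perm_mx a = [delta_{i a, j}] *)
Definition monomial_with_perm (g : 'M[F]_p) (a : 'S_p) : Prop :=
  exists2 d : 'rV[F]_p, (forall i, d 0 i != 0) & g = diag_mx d *m perm_mx a.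

Definition is_monomial (g : 'M[F]_p) : Prop := exists a, monomial_with_perm g a.

Definition perm_part (G : mxset) (a : 'S_p) : Prop :=
  exists2 g, G g & monomial_with_perm g a.

Definition mx_irreducible_set (G : mxset) : Prop :=
  forall U : 'M[F]_p, (forall g, G g -> (U *m g <= U)%MS) ->
    \rank U = 0%N \/ \rank U = p.

Definition fin_irr_monomial_group (G : mxset) : Prop :=
  [/\ is_subgroup G, is_finite_set G, set_sub G is_monomial &
      mx_irreducible_set G].

Definition admissible_diag (A : mxset) : Prop :=
  [/\ is_subgroup A, is_finite_set A, set_sub A is_diag_inv,
      (forall a : 'S_p, set_eq (conj_set (perm_mx a) A) A) &
      ~ set_sub A is_scalar].

Definition nat_perm_mx (f : nat -> nat) : 'M[F]_p :=
  \matrix_(i, j) ((nat_of_ord j == f i)%:R).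

(* s = permutation matrix of the p-cycle (1,2,...,p), i.e. i |-> i+1 mod p
   on indices 0..p-1 *)
Definition s_mx : 'M[F]_p := nat_perm_mx (fun i => (i.+1 %% p)%N).

(* w = permutation matrix of the 3-cycle (1,2,3), i.e. 0->1->2->0 on 0..p-1 *)
Definition w_mx : 'M[F]_p :=
  nat_perm_mx (fun i => if i == 0%N then 1%N else if i == 1%N then 2%N
                        else if i == 2%N then 0%N else i).

Definition swA (A : mxset) : mxset :=
  gen_group (fun g => g = s_mx \/ g = w_mx \/ A g).

End MonomialGroups.

(* Main.v *)
Require Import Defs.
From mathcomp Require Import all_boot all_algebra all_fingroup reals complex.
From mathcomp Require Import ring zify.
From mathcomp Require boolp.
Import GRing.Theory Num.Theory.
Set Implicit Arguments. Unset Strict Implicit. Unset Printing Implicit Defensive.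
Local Open Scope ring_scope.

(* Let G be a group of monomial matrices with permutation part Alt(p) and diagonal
   subgroup D. The ratios x_i/x_j of entries of elements of D form a group X, and
   commutators with two 3-cycles show that D contains every diagonal matrix with
   entries in X and determinant 1; in particular D is invariant under Sym(p).
   As a 3-cycle is a commutator of 3-cycles fixing two prescribed further points,
   a lift of a 3-cycle has, modulo X, the same entry at all its fixed points.
   After rescaling these entries to 1, the entry of a lift of (i j k) at i does
   not depend on k modulo X, so conjugation by a diagonal matrix makes all ratios
   of entries of lifts of even permutations lie in X. Commutators of such lifts
   have determinant-1 defect in X, so the conjugate of G contains the 3-cycles
   themselves, and equals D Alt(p) = <s, w, D>. If D were scalar, this group would
   fix a line.
   Conversely the coordinate characters of a nonscalar Sym(p)-invariant A are
   distinct, which gives irreducibility. If P conjugates A Alt(p) to B Alt(p), the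
   conjugate of B has abelian normal, hence trivial, image in Alt(p), so it lies in
   A; comparing the distinct characters, P is monomial, and B lies in A. *)

(** * Three-cycles and generation of the alternating group *)

Section EvenPermutations.
Local Open Scope group_scope.
Variable p : nat.
Implicit Types (a b c d e i j k z : 'I_p) (t u : 'S_p).

Lemma exists_notin (r : seq 'I_p) : (size r < p)%N -> exists z, z \notin r.
Proof.
move=> ltrp; have [/existsP [z zr] | /existsPn rT] := boolP [exists z, z \notin r].
  by exists z.
have := uniq_leq_size (enum_uniq 'I_p) (fun z _ => negbNE (rT z)).
by rewrite -cardE card_ord leqNgt ltrp.
Qed.

(* Locked, since otherwise [permM] unfolds the product. *)
Definition cyc a b c : 'S_p := locked (tperm a b * tperm a c).

Lemma cycD a b c : cyc a b c = tperm a b * tperm a c.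
Proof. by rewrite /cyc -lock. Qed.

Lemma cycE a b c z : uniq [:: a; b; c] ->
  cyc a b c z = if z == a then b else if z == b then c else if z == c then a else z.
Proof.
rewrite /= !inE negb_or andbT => /andP [/andP [nab nac] nbc].
rewrite cycD permM; case: (eqVneq z a) => [->|nza].
  by rewrite tpermL tpermD // eq_sym.
case: (eqVneq z b) => [->|nzb]; first by rewrite tpermR tpermL.
rewrite (tpermD (z := z)) ?(eq_sym _ z) //.
by case: (eqVneq z c) => [->|nzc]; rewrite ?tpermR // tpermD ?(eq_sym _ z).
Qed.

Lemma cyc_1 a b c : uniq [:: a; b; c] -> cyc a b c a = b.
Proof. by move=> abc; rewrite cycE // eqxx. Qed.

Lemma cyc_2 a b c : uniq [:: a; b; c] -> cyc a b c b = c.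
Proof.
move=> abc; rewrite cycE // eqxx; case: eqP abc => // -> /=.
by rewrite inE eqxx.
Qed.

Lemma cyc_3 a b c : uniq [:: a; b; c] -> cyc a b c c = a.
Proof.
move=> abc; rewrite cycE // eqxx; move: abc; rewrite /= !inE negb_or andbT.
by case/andP => /andP [_ ac] bc; rewrite !(eq_sym c) (negPf ac) (negPf bc).
Qed.

Lemma even_cyc a b c : uniq [:: a; b; c] -> ~~ odd_perm (cyc a b c).
Proof.
rewrite /= !inE negb_or andbT => /andP [/andP [nab nac] _].
by rewrite cycD odd_permM !odd_tperm nab nac.
Qed.

Lemma cycJ a b c t : cyc a b c ^ t = cyc (t a) (t b) (t c).
Proof. by rewrite !cycD conjMg !tpermJ. Qed.

Lemma cyc_fix a b c z : uniq [:: a; b; c; z] -> cyc a b c z = z.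
Proof.
rewrite /= !inE !negb_or !andbT => /and3P [/and3P [nab nac naz] /andP [nbc nbz] ncz].
rewrite cycE /= ?inE ?negb_or ?nab ?nac ?nbc //.
by rewrite !(eq_sym z) (negPf naz) (negPf nbz) (negPf ncz).
Qed.

(** Two transpositions give a permutation with the required values; if it is odd, precomposing it
    with a transposition of two points outside [i'] and [j'] repairs the parity. *)
Lemma even_perm2 i j i' j' : (3 < p)%N -> i != j -> i' != j' ->
  exists t, [/\ ~~ odd_perm t, t i' = i & t j' = j].
Proof.
move=> p_gt3 nij nij'.
pose u := tperm i' i * tperm (tperm i' i j') j.
have nij1 : i != tperm i' i j' by rewrite -{1}(tpermL i' i) (inj_eq perm_inj).
have ui : u i' = i by rewrite permM tpermL tpermD // eq_sym.
have uj : u j' = j by rewrite permM tpermL.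
have [k] := exists_notin (r := [:: i'; j']) (ltnW p_gt3).
have [l] := exists_notin (r := [:: i'; j'; k]) p_gt3.
rewrite !inE !negb_or => /and3P [li lj lk] /andP [ki kj].
case: (boolP (odd_perm u)) => ou; last by exists u.
exists (tperm k l * u); split.
- by rewrite odd_permM odd_tperm ou eq_sym lk.
- by rewrite permM tpermD.
- by rewrite permM tpermD.
Qed.

(** This is the commutator identity (a b c) = [(a c d), (a b e)] with inverses cleared, so that it
    applies to products of lifts. The points [d] and [e] are free, so both factors can avoid
    prescribed points. *)
Lemma cyc_comm a b c d e : uniq [:: a; b; c; d; e] ->
  cyc a c d * cyc a b e = cyc a b e * cyc a c d * cyc a b c.
Proof.
rewrite /= !inE !negb_or !andbT.
case/and4P => /and4P [ab ac ad ae] /and3P [bc bd be] /andP [cd ce] de.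
apply/permP => z; rewrite !permM !cycE /= ?inE ?negb_or ?ab ?ac ?ad ?ae ?bc ?bd ?be ?cd ?ce ?de //.
have S (x y : 'I_p) : x != y -> ((x == y) = false) * ((y == x) = false).
  by move=> h; rewrite (eq_sym y) (negPf h).
have E := (S _ _ ab, S _ _ ac, S _ _ ad, S _ _ ae, S _ _ bc, S _ _ bd, S _ _ be,
           S _ _ cd, S _ _ ce, S _ _ de, eqxx).
case: (eqVneq z a) => [? | /S za]; first by subst z; rewrite ?E.
case: (eqVneq z b) => [? | /S zb]; first by subst z; rewrite ?E.
case: (eqVneq z c) => [? | /S zc]; first by subst z; rewrite ?E.
case: (eqVneq z d) => [? | /S zd]; first by subst z; rewrite ?E.
case: (eqVneq z e) => [? | /S ze]; first by subst z; rewrite ?E.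
by rewrite ?(za, zb, zc, zd, ze).
Qed.

Lemma cyc_rot a b c : uniq [:: a; b; c] -> cyc a b c = cyc b c a.
Proof.
move=> abc; have bca : uniq [:: b; c; a] by rewrite -(rot_uniq 2).
apply/permP => z; rewrite !cycE //.
move: abc; rewrite /= !inE negb_or andbT => /andP [/andP [ab ac] bc].
case: (eqVneq z a) => [->|_]; last by do 2?case: ifP.
by rewrite (negPf ab) (negPf ac).
Qed.

(** Trades the third point [k] for [k'] at the cost of a factor that fixes [i]. *)
Lemma cyc_third i j k k' : uniq [:: i; j; k; k'] ->
  cyc i j k = cyc j k k' * cyc i j k'.
Proof.
rewrite /= !inE !negb_or !andbT.
case/and3P => /and3P [ij ik ik'] /andP [jk jk'] kk'.
apply/permP => z; rewrite !permM !cycE /= ?inE ?negb_or ?ij ?ik ?ik' ?jk ?jk' ?kk' //.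
have S (x y : 'I_p) : x != y -> ((x == y) = false) * ((y == x) = false).
  by move=> h; rewrite (eq_sym y) (negPf h).
have E := (S _ _ ij, S _ _ ik, S _ _ ik', S _ _ jk, S _ _ jk', S _ _ kk', eqxx).
case: (eqVneq z i) => [? | /S za]; first by subst z; rewrite ?E.
case: (eqVneq z j) => [? | /S zb]; first by subst z; rewrite ?E.
case: (eqVneq z k) => [? | /S zc]; first by subst z; rewrite ?E.
case: (eqVneq z k') => [? | /S zd]; first by subst z; rewrite ?E.
by rewrite ?(za, zb, zc, zd).
Qed.

Lemma even_perm_supp2 t : ~~ odd_perm t -> (forall z, (1 < z)%N -> t z = z) -> t = 1.
Proof.
move=> et t2; apply/permP => z; rewrite perm1; apply/eqP; apply: contraT => tz.
have small x y : (1 < t x)%N -> t x = x.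
  by move=> /t2 /perm_inj.
have lt2 x : t x != x -> (x <= 1)%N.
  by move=> tx; rewrite leqNgt; apply: contra tx => /t2 ->.
have nfix x : t x != x -> t (t x) != t x by rewrite (inj_eq perm_inj).
have z1 := lt2 _ tz; have tz1 := lt2 _ (nfix _ tz).
have ttz1 := lt2 _ (nfix _ (nfix _ tz)).
have tt : t (t z) = z.
  by apply: val_inj; have := nfix _ tz; move: tz z1 tz1 ttz1; rewrite -!val_eqE /=; lia.
suff tE : t = tperm z (t z) by have := odd_tperm z (t z); rewrite -tE eq_sym tz (negPf et).
apply/permP => x; case: tpermP => [->|->|/eqP nxz /eqP nxtz] //.
apply: t2; move: tz z1 tz1 nxz nxtz; rewrite -!val_eqE /=; lia.
Qed.

(** Generation of Alt(p) by 3-cycles of consecutive points, by induction on a bound for the moved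
    points: a product of such cycles with the same value at the largest point is divided out. *)
Lemma even_perm_ind (H : 'S_p -> Prop) :
  H 1 -> (forall t u, H t -> H u -> H (t * u)) ->
  (forall i j k, j = i.+1 :> nat -> k = i.+2 :> nat -> H (cyc i j k)) ->
  forall t, ~~ odd_perm t -> H t.
Proof.
move=> H1 HM Hc.
have hit m : forall n j : 'I_p, (1 < n)%N -> (j <= n)%N -> (n - j = m)%N ->
    exists h, [/\ H h, ~~ odd_perm h, h n = j & forall z, (n < z)%N -> h z = z].
  elim/ltn_ind: m => m IH n j n1 jn nj.
  (* The image of [n] descends two places at a time by (j j+1 j+2). The remaining targets are [n],
     reached by the identity, and n-1, reached by the square of (n-2 n-1 n). *)
  case: (ltnP j.+1 n) => [jn2 | jn2].
    have j1 : (j.+1 < p)%N by apply: ltn_trans jn2 (ltn_ord n).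
    have j2 : (j.+2 < p)%N by apply: leq_ltn_trans jn2 (ltn_ord n).
    pose a := Ordinal j1; pose b := Ordinal j2.
    have U : uniq [:: j; a; b] by rewrite /= !inE -!val_eqE /=; lia.
    have [|||h [Hh eh hn hf]] := IH (n - j.+2)%N _ n b n1 => //; first by lia.
    exists (h * cyc j a b); split.
    - by apply: HM => //; apply: Hc.
    - by rewrite odd_permM (negPf eh) even_cyc.
    - by rewrite permM hn cyc_3.
    - by move=> z nz; rewrite permM hf // cyc_fix //= !inE -!val_eqE /=; lia.
  move: jn; rewrite leq_eqVlt => /orP [/eqP jn | jn].
    by exists 1; split; rewrite ?odd_perm1 ?perm1 //; [apply: val_inj | move=> z; rewrite perm1].
  have n2 : (n.-2 < p)%N by apply: leq_ltn_trans (ltn_ord n); lia.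
  pose a := Ordinal n2.
  have U : uniq [:: a; j; n] by rewrite /= !inE -!val_eqE /=; lia.
  exists (cyc a j n * cyc a j n).
  have Ha : H (cyc a j n) by apply: Hc => /=; lia.
  split; [exact: HM | by rewrite odd_permM addbb | | ].
    by rewrite permM cyc_3 // cyc_1.
  by move=> z nz; rewrite permM !cyc_fix //= !inE -!val_eqE /=; lia.
suff ind n t : ~~ odd_perm t -> (forall z, (n < z)%N -> t z = z) -> H t.
  by move=> t et; apply: (ind p) => // z; rewrite ltnNge ltnW.
elim: n t => [|n IH] t et tf.
  by rewrite (even_perm_supp2 et) // => z /ltnW; apply: tf.
case: n IH tf => [|n] IH tf; first by rewrite (even_perm_supp2 et).
case: (ltnP n.+2 p) => [np | pn]; last first.
  by apply: IH => // z nz; have := ltn_ord z; rewrite ltnNge (leq_trans pn).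
pose x := Ordinal np.
have tx : (t x <= x)%N.
  by rewrite leqNgt; apply/negP => ht; have := tf _ ht => /perm_inj E; rewrite E ltnn in ht.
have [//|//|//|h [Hh eh hx hf]] := hit (x - t x)%N x (t x).
rewrite -(mulgKV h t); apply: HM => //.
apply: IH; first by rewrite odd_permM odd_permV (negPf eh) (negPf et).
move=> z; rewrite leq_eqVlt => /orP [/eqP zx | zx].
  have -> : z = x by apply: val_inj.
  by rewrite permM -hx permK.
by rewrite permM tf // -{1}(hf _ zx) permK.
Qed.

(** Suppose [t] sends [i] to another point [j]. Evaluating at [i] the commutation of [t] with its
    conjugate under (j k m) forces [t m = k]; two choices of [m] contradict injectivity. *)
Lemma commuting_conjugates_id t : (4 < p)%N ->
  (forall a b c, uniq [:: a; b; c] -> commute t (t ^ cyc a b c)) -> t = 1.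
Proof.
move=> p_gt4 tC; apply/permP => i; rewrite perm1; apply/eqP; apply: contraT => nij.
set j := t i in nij.
have [k] := exists_notin (r := [:: i; j]) (ltnW (ltnW p_gt4)).
have [l] := exists_notin (r := [:: i; j; k]) (ltnW p_gt4).
have [l'] := exists_notin (r := [:: i; j; k; l]) p_gt4.
rewrite !inE !negb_or => /and4P [l'i l'j l'k l'l] /and3P [li lj lk] /andP [ki kj].
suff tk m : m != i -> m != j -> m != k -> t m = k.
  have := tk l li lj lk; rewrite -(tk l' l'i l'j l'k) => /perm_inj /eqP.
  by rewrite eq_sym (negPf l'l).
move=> mi mj mk.
have U : uniq [:: j; k; m] by rewrite /= !inE negb_or !andbT !(eq_sym j) kj mj eq_sym mk.
have cV (z : 'I_p) : (t ^ cyc j k m) (cyc j k m z) = cyc j k m (t z) by rewrite permJ.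
have ci : cyc j k m i = i by rewrite cycE // !(eq_sym i) (negPf nij) (negPf ki) (negPf mi).
have := tC _ _ _ U; move: cV; move: (t ^ _) => u cV /permP /(_ i).
have := cV m; have := cV i; rewrite ci -/j (cyc_1 U) (cyc_3 U) => ui uj.
rewrite !permM -/j uj ui cycE // {1}/j (inj_eq perm_inj) (negPf mi).
case: eqP => // _; case: eqP => [_ | _ /perm_inj /eqP]; last by rewrite (negPf mk).
by rewrite /j => /perm_inj /eqP; rewrite eq_sym (negPf ki).
Qed.

End EvenPermutations.

(** * Calculus of monomial matrices, with the diagonal factor given as a function *)

Section MonomialMatrices.
Variables (F : fieldType) (p : nat).
Implicit Types (d e x y : 'I_p -> F) (t u : 'S_p) (g : 'M[F]_p).

Definition mon d t : 'M[F]_p := \matrix_(i, j) (d i *+ (t i == j)).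

Lemma mon_ext d e t : d =1 e -> mon d t = mon e t.
Proof. by move=> de; apply/matrixP => i j; rewrite !mxE de. Qed.

Lemma mulmx_monE (m : nat) (g : 'M[F]_(m, p)) d t i j : (g *m mon d t) i (t j) = g i j * d j.
Proof.
rewrite mxE (bigD1 j) //= mxE eqxx big1 ?addr0 // => k kj.
by rewrite mxE (inj_eq perm_inj) (negPf kj) mulr0.
Qed.

Lemma mon_mulmxE (m : nat) (g : 'M[F]_(p, m)) d t i j : (mon d t *m g) i j = d i * g (t i) j.
Proof.
rewrite mxE (bigD1 (t i)) //= mxE eqxx big1 ?addr0 // => k kj.
by rewrite mxE eq_sym (negPf kj) mul0r.
Qed.

Lemma monM d e t u : mon d t *m mon e u = mon (fun i => d i * e (t i)) (t * u)%g.
Proof. by apply/matrixP => i j; rewrite mon_mulmxE !mxE permM mulrnAr. Qed.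

Lemma mon1 : mon (fun=> 1) 1%g = 1%:M.
Proof. by apply/matrixP => i j; rewrite !mxE perm1. Qed.

Lemma mon_scalar (c : F) : mon (fun=> c) 1%g = c%:M.
Proof. by apply/matrixP => i j; rewrite !mxE perm1. Qed.

Lemma perm_mxE t : perm_mx t = mon (fun=> 1) t.
Proof. by apply/matrixP => i j; rewrite !mxE. Qed.

Lemma diag_mxE (d : 'rV[F]_p) : diag_mx d = mon (d 0) 1%g.
Proof. by apply/matrixP => i j; rewrite !mxE perm1; case: eqP => [->|]. Qed.

Lemma diag_perm_mxE (d : 'rV[F]_p) t : diag_mx d *m perm_mx t = mon (d 0) t.
Proof.
by rewrite diag_mxE perm_mxE monM mul1g; apply: mon_ext => i; rewrite mulr1.
Qed.

Lemma mon_diag_perm d t : mon d t = diag_mx (\row_i d i) *m perm_mx t.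
Proof. by rewrite diag_perm_mxE; apply: mon_ext => i; rewrite mxE. Qed.

Lemma mon_diag d : mon d 1%g = diag_mx (\row_i d i).
Proof. by rewrite diag_mxE; apply: mon_ext => i; rewrite mxE. Qed.

Lemma mon_inj d e t u : (forall i, d i != 0) -> mon d t = mon e u -> t = u /\ d =1 e.
Proof.
move=> d0 /matrixP E.
have tu i : u i = t i.
  have := E i (t i); rewrite !mxE eqxx; case: eqP => // _ /eqP.
  by rewrite mulr0n (negPf (d0 i)).
split; first by apply/permP => i; rewrite tu.
by move=> i; have := E i (t i); rewrite !mxE tu eqxx.
Qed.

Lemma mon_invr d t : (forall i, d i != 0) ->
  mon d t *m mon (fun i => (d (t^-1 i)%g)^-1) t^-1%g = 1%:M.
Proof.
move=> d0; rewrite monM mulgV -mon1; apply: mon_ext => i.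
by rewrite permK divff.
Qed.

Lemma mon_unit d t : (mon d t \in unitmx) <-> (forall i, d i != 0).
Proof.
split=> [U i | d0]; last by have [] := mulmx1_unit (mon_invr t d0).
apply/eqP => di; have := mulmxV U => /matrixP /(_ i i).
by rewrite mon_mulmxE di mul0r !mxE eqxx => /esym /eqP; rewrite oner_eq0.
Qed.

Lemma invmx_mon d t : (forall i, d i != 0) ->
  invmx (mon d t) = mon (fun i => (d (t^-1 i)%g)^-1) t^-1%g.
Proof.
move=> d0; have U : mon d t \in unitmx by apply/mon_unit.
by rewrite -[LHS]mulmx1 -(mon_invr t d0) mulmxA mulVmx // mul1mx.
Qed.

Lemma is_diag_invP g : is_diag_inv g <-> exists2 d, (forall i, d i != 0) & g = mon d 1%g.
Proof.
split=> [[d d0 ->] | [d d0 ->]]; first by exists (d 0); rewrite ?diag_mxE.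
by exists (\row_i d i); rewrite ?mon_diag // => i; rewrite mxE.
Qed.

Lemma monomial_with_permP g t :
  monomial_with_perm g t <-> exists2 d, (forall i, d i != 0) & g = mon d t.
Proof.
split=> [[d d0 ->] | [d d0 ->]]; first by exists (d 0); rewrite ?diag_perm_mxE.
by exists (\row_i d i); rewrite ?mon_diag_perm // => i; rewrite mxE.
Qed.

(** For distinct [i] and [j] these are the elementary diagonal matrices of determinant 1. *)
Definition eps (i j : 'I_p) (c : F) : 'I_p -> F :=
  fun k => if k == i then c else if k == j then c^-1 else 1.

End MonomialMatrices.

(** * The diagonal subgroup of a group that lifts every even permutation *)

Section AlternatingPermutationPart.
Variables (F : fieldType) (p : nat) (p_gt6 : (6 < p)%N) (G : mxset F p).
Hypotheses (G_subgroup : is_subgroup G)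
  (G_lift : forall t : 'S_p, ~~ odd_perm t -> exists d, G (mon d t)).
Implicit Types (d x y : 'I_p -> F) (t u : 'S_p) (i j k l : 'I_p) (c : F).

Let GM (g h : 'M_p) : G g -> G h -> G (g *m h). Proof. by case: G_subgroup => _ _ + _; apply. Qed.
Let GV (g : 'M_p) : G g -> G (invmx g). Proof. by case: G_subgroup => _ _ _; apply. Qed.
Let GU (g : 'M_p) : G g -> g \in unitmx. Proof. by case: G_subgroup => _ + _ _; apply. Qed.

Lemma lift_neq0 d t i : G (mon d t) -> d i != 0.
Proof. by move=> /GU /mon_unit. Qed.

Definition diag_part x := G (mon x 1%g).

Lemma diag_part_ext x y : x =1 y -> diag_part x -> diag_part y.
Proof. by move=> xy; rewrite /diag_part (mon_ext _ xy). Qed.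

Lemma diag_partM x y : diag_part x -> diag_part y -> diag_part (fun i => x i * y i).
Proof.
move=> Dx Dy; have := GM Dx Dy; rewrite monM mulg1; apply: diag_part_ext => i.
by rewrite perm1.
Qed.

Lemma lift_ratio d (e : 'I_p -> F) t : G (mon d t) -> G (mon e t) -> diag_part (fun i => d i / e i).
Proof.
move=> Gd Ge; have e0 i := lift_neq0 i Ge.
have := GM Gd (GV Ge); rewrite invmx_mon // monM mulgV; apply: diag_part_ext => i.
by rewrite permK.
Qed.

Lemma diag_part1 : diag_part (fun=> 1).
Proof. by rewrite /diag_part mon1; case: G_subgroup. Qed.

Lemma diag_partV x : diag_part x -> diag_part (fun i => (x i)^-1).
Proof. by move=> Dx; apply: diag_part_ext (lift_ratio diag_part1 Dx) => i; rewrite div1r. Qed.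

Lemma diag_part_div x y : diag_part x -> diag_part y -> diag_part (fun i => x i / y i).
Proof. exact: lift_ratio. Qed.

(** Conjugation by a lift of [t] only permutes the entries, since the diagonal factor of the lift
    commutes with [x]. *)
Lemma diag_part_conj t x : ~~ odd_perm t -> diag_part x -> diag_part (x \o t).
Proof.
move=> /G_lift [d Gd] Dx; have d0 i := lift_neq0 i Gd.
have := GM (GM Gd Dx) (GV Gd); rewrite invmx_mon // !monM mulg1 mulgV.
by apply: diag_part_ext => i /=; rewrite permK mulrAC divff ?mul1r.
Qed.

(* The group of all ratios x i / x j with x in the diagonal part, see
   [diag_part_ratio]. *)
Definition ratio_group c := forall i j, i != j -> diag_part (eps i j c).

Lemma ratio_group_of_eps i j c : i != j -> diag_part (eps i j c) -> ratio_group c.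
Proof.
move=> ij De k l kl.
have [|t [et tk tl]] := even_perm2 _ ij kl; first by lia.
apply: diag_part_ext (diag_part_conj et De) => z /=.
by rewrite /eps -tk -tl !(inj_eq perm_inj).
Qed.

Lemma ratio_group1 : ratio_group 1.
Proof.
move=> i j ij; apply: diag_part_ext diag_part1 => k.
by rewrite /eps invr1; do 2?case: ifP.
Qed.

Lemma ratio_groupM b c : ratio_group b -> ratio_group c -> ratio_group (b * c).
Proof.
move=> Xb Xc i j ij; apply: diag_part_ext (diag_partM (Xb i j ij) (Xc i j ij)) => k.
by rewrite /eps invfM; do 2?case: ifP; rewrite ?mulr1.
Qed.

Lemma ratio_groupV c : ratio_group c -> ratio_group c^-1.
Proof.
move=> Xc i j ij; apply: diag_part_ext (diag_partV (Xc i j ij)) => k.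
by rewrite /eps; do 2?case: ifP; rewrite ?invr1.
Qed.

Lemma ratio_group_div b c : ratio_group b -> ratio_group c -> ratio_group (b / c).
Proof. by move=> Xb /ratio_groupV; apply: ratio_groupM. Qed.

(* For x in diag_part, x o (i j m) / x is supported on {i, j, m}; dividing it by its
   conjugate under (i k l) leaves only the entries at i and l. *)
Lemma diag_part_ratio x i j : diag_part x -> ratio_group (x i / x j).
Proof.
move=> Dx; have x0 z := lift_neq0 z Dx.
have [<-|ij] := eqVneq i j; first by rewrite divff //; apply: ratio_group1.
have [m] := @exists_notin p [:: i; j] ltac:(rewrite /=; lia).
have [k] := @exists_notin p [:: i; j; m] ltac:(rewrite /=; lia).
have [l] := @exists_notin p [:: i; j; m; k] ltac:(rewrite /=; lia).
rewrite !inE !negb_or => /and4P [li lj lm lk] /and3P [ki kj km] /andP [mi mj].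
have S (y z : 'I_p) : y != z -> ((y == z) = false) * ((z == y) = false).
  by move=> h; rewrite (eq_sym z) (negPf h).
have E := (S _ _ ij, S _ _ li, S _ _ lj, S _ _ lm, S _ _ lk, S _ _ ki, S _ _ kj,
  S _ _ km, S _ _ mi, S _ _ mj, eqxx).
have U1 : uniq [:: i; j; m] by rewrite /= !inE !E.
have U2 : uniq [:: i; k; l] by rewrite /= !inE !E.
have Db := diag_part_div (diag_part_conj (even_cyc U1) Dx) Dx.
have Dq := diag_part_div Db (diag_part_conj (even_cyc U2) Db).
(* The surviving entry at [i] is [x j / x i], the inverse of the ratio sought, and the entry at [l]
   is its inverse. *)
rewrite -invf_div; apply: ratio_groupV; apply: (@ratio_group_of_eps i l); first by rewrite !E.
apply: diag_part_ext Dq => z; rewrite /eps /= !cycE //.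
case: (eqVneq z i) => [? | /S zi]; first by subst z; rewrite !E divff // divr1.
case: (eqVneq z j) => [? | /S zj].
  by subst z; rewrite !E divff // mulf_neq0 // invr_eq0.
case: (eqVneq z k) => [? | /S zk]; first by subst z; rewrite !E ?divff ?oner_eq0.
case: (eqVneq z l) => [? | /S zl]; first by subst z; rewrite !E divff // div1r.
by rewrite !(zi, zj) divff // mulf_neq0 // invr_eq0.
Qed.

Lemma ratio_group_neq0 c : ratio_group c -> c != 0.
Proof.
have [i _] := @exists_notin p [::] ltac:(rewrite /=; lia).
have [j] := @exists_notin p [:: i] ltac:(rewrite /=; lia).
rewrite inE eq_sym => ij Xc; have := lift_neq0 i (Xc i j ij).
by rewrite /eps eqxx.
Qed.

Lemma diag_part_prod (I : Type) (r : seq I) (P : pred I) (f : I -> 'I_p -> F) :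
  (forall a, P a -> diag_part (f a)) -> diag_part (fun i => \prod_(a <- r | P a) f a i).
Proof.
move=> Df; elim: r => [|k r IH].
  by apply: diag_part_ext diag_part1 => i; rewrite big_nil.
have [Pk|nPk] := boolP (P k).
  by apply: diag_part_ext (diag_partM (Df k Pk) IH) => i; rewrite big_cons Pk.
by apply: diag_part_ext IH => i; rewrite big_cons (negPf nPk).
Qed.

(** Fix a point [o]; then [y] is the product of the [eps k o (y k)] over the other [k], and the
    determinant condition makes the entries at [o] agree. *)
Lemma diag_part_of_prod1 y : (forall i, ratio_group (y i)) -> \prod_i y i = 1 -> diag_part y.
Proof.
move=> Xy y1; have [o _] := @exists_notin p [::] ltac:(rewrite /=; lia).
have Df k : k != o -> diag_part (eps k o (y k)) by move=> ko; apply: Xy.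
apply: diag_part_ext (diag_part_prod (index_enum _) Df) => i.
have [->|io] := eqVneq i o.
  have yo : y o * \prod_(k | k != o) y k = 1 by move: y1; rewrite (bigD1 o).
  transitivity (\prod_(k | k != o) (y k)^-1).
    by apply: eq_bigr => k ko; rewrite /eps eq_sym (negPf ko) eqxx.
  have P0 : \prod_(k | k != o) y k != 0 by apply/prodf_neq0 => k _; apply: ratio_group_neq0.
  by apply: (mulIf P0); rewrite yo prodfV mulVf.
rewrite (bigD1 i) //= /eps eqxx big1 ?mulr1 // => k /andP [ko ki].
by rewrite eq_sym (negPf ki) (negPf io).
Qed.

(** It remains to treat one transposition (i j), and swapping two entries of [y] amounts to
    multiplying by [eps i j (y j / y i)]. *)
Lemma diag_part_conj_all t x : diag_part x -> diag_part (x \o t).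
Proof.
case: (boolP (odd_perm t)) => [ot | et]; last exact: diag_part_conj.
have [i _] := @exists_notin p [::] ltac:(rewrite /=; lia).
have [j] := @exists_notin p [:: i] ltac:(rewrite /=; lia).
rewrite inE eq_sym => ij.
have tr y : diag_part y -> diag_part (y \o tperm i j).
  move=> Dy; have y0 z := lift_neq0 z Dy.
  apply: diag_part_ext (diag_partM (diag_part_ratio j i Dy ij) Dy) => z /=; rewrite /eps.
  case: tpermP => [->|->|/eqP/negPf -> /eqP/negPf ->]; rewrite ?mul1r // ?eqxx.
    by rewrite divfK.
  by rewrite eq_sym (negPf ij) invf_div divfK.
move=> Dx; have et : ~~ odd_perm (tperm i j * t) by rewrite odd_permM odd_tperm ij ot.
apply: diag_part_ext (tr _ (diag_part_conj et Dx)) => z /=.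
by rewrite permM tpermK.
Qed.


(** * Lifts of 3-cycles modulo the group of ratios *)

Lemma lift_prod d (e : 'I_p -> F) t u : G (mon d t) -> G (mon e u) ->
  G (mon (fun i => d i * e (t i)) (t * u)%g).
Proof. by move=> Gd Ge; rewrite -monM; apply: GM. Qed.

(* A 3-cycle is a commutator of two 3-cycles fixing i and j, and a commutator
   of lifts has entry 1 at every common fixed point. *)
Lemma fix_ratio (a b c i j : 'I_p) d : uniq [:: a; b; c; i] -> uniq [:: a; b; c; j] ->
  G (mon d (cyc a b c)) -> ratio_group (d i / d j).
Proof.
move=> Ui Uj Gd; have d0 z := lift_neq0 z Gd.
have [f] := @exists_notin p [:: a; b; c; i; j] ltac:(rewrite /=; lia).
have [e] := @exists_notin p [:: a; b; c; i; j; f] ltac:(rewrite /=; lia).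
rewrite !inE !negb_or => /and5P [ea eb ec ei /andP [ej ef]] /and5P [fa fb fc fi fj].
move: Ui Uj; rewrite /= !inE !negb_or !andbT.
move=> /and3P [/and3P [ab ac ai] /andP [bc bi] ci] /and3P [/and3P [_ _ aj] /andP [_ bj] cj].
have S (y z : 'I_p) : y != z -> ((y == z) = false) * ((z == y) = false).
  by move=> h; rewrite (eq_sym z) (negPf h).
have E := (S _ _ ea, S _ _ eb, S _ _ ec, S _ _ ei, S _ _ ej, S _ _ ef, S _ _ fa,
  S _ _ fb, S _ _ fc, S _ _ fi, S _ _ fj, (S _ _ ab, S _ _ ac, S _ _ ai, S _ _ bc,
  S _ _ bi, S _ _ ci, S _ _ aj, S _ _ bj, S _ _ cj)).
have [du Gu] : exists d, G (mon d (cyc a c f)).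
  by apply/G_lift/even_cyc; rewrite /= !inE !E.
have [dv Gv] : exists d, G (mon d (cyc a b e)).
  by apply/G_lift/even_cyc; rewrite /= !inE !E.
have du0 z := lift_neq0 z Gu; have dv0 z := lift_neq0 z Gv.
have Guv := lift_prod Gu Gv; have := lift_prod (lift_prod Gv Gu) Gd.
rewrite -cyc_comm; last by rewrite /= !inE !E.
(* At [i] and [j] the entries of [du] and [dv] cancel, leaving the inverse of [d]; hence the order
   [j i] of the ratio. *)
move=> Gvu; have := diag_part_ratio j i (lift_ratio Guv Gvu).
rewrite !permM !(@cyc_fix _ a b e) ?(@cyc_fix _ a c f) /= ?inE ?E //.
congr (ratio_group _); field.
by rewrite !(d0, du0, dv0, oner_eq0).
Qed.

(* The entry at i of a lift of a 3-cycle (i j k), rescaled to have entry 1 at a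
   fixed point l; it is well defined modulo the group of ratios. *)
Definition normalized_entry i j c :=
  exists k l d, [/\ uniq [:: i; j; k; l], G (mon d (cyc i j k)) & c = d i / d l].

Lemma normalized_entry_exists i j : i != j -> exists c, normalized_entry i j c.
Proof.
move=> ij.
have [k] := @exists_notin p [:: i; j] ltac:(rewrite /=; lia).
have [l] := @exists_notin p [:: i; j; k] ltac:(rewrite /=; lia).
rewrite !inE !negb_or => /and3P [li lj lk] /andP [ki kj].
have U : uniq [:: i; j; k; l].
  by rewrite /= !inE !negb_or ij !(eq_sym i) ki li !(eq_sym j) kj lj eq_sym lk.
have [d Gd] := G_lift (even_cyc (subseq_uniq (prefix_subseq [:: i; j; k] [:: l]) U)).
by exists (d i / d l), k, l, d.
Qed.

(** By [fix_ratio] both entries may be normalized at a common fixed point [m]. If the third points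
    differ, [cyc_third] compares the lifts, and its extra factor (j k k') fixes both [i] and [m], so
    it contributes only a ratio in the group. *)
Lemma normalized_entry_unique i j b c :
  normalized_entry i j b -> normalized_entry i j c -> ratio_group (b / c).
Proof.
move=> [k [l [d [U Gd ->]]]] [k' [l' [d' [U' Gd' ->]]]].
have d0 z := lift_neq0 z Gd; have d'0 z := lift_neq0 z Gd'.
have [m] := @exists_notin p [:: i; j; k; k'] ltac:(rewrite /=; lia).
rewrite !inE !negb_or => /and4P [mi mj mk mk'].
have Um : uniq [:: i; j; k; m].
  move: U; rewrite /= !inE !negb_or !andbT !(eq_sym _ m) mi mj mk.
  by case/and3P => /and3P [-> -> _] /andP [-> _] _.
have Um' : uniq [:: i; j; k'; m].
  move: U'; rewrite /= !inE !negb_or !andbT !(eq_sym _ m) mi mj mk'.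
  by case/and3P => /and3P [-> -> _] /andP [-> _] _.
have Xl := fix_ratio U Um Gd; have Xl' := fix_ratio U' Um' Gd'.
suff Xm : ratio_group ((d i / d m) / (d' i / d' m)).
  have := ratio_group_div (ratio_groupM Xm Xl') Xl.
  congr (ratio_group _); field.
  by rewrite !(d0, d'0, oner_eq0).
have [Ek | kk'] := eqVneq k k'.
  rewrite -{k'}Ek in Gd' U' Um' mk' *.
  have := diag_part_ratio i m (lift_ratio Gd Gd').
  congr (ratio_group _); field.
  by rewrite !(d0, d'0, oner_eq0).
have S (y z : 'I_p) : y != z -> ((y == z) = false) * ((z == y) = false).
  by move=> h; rewrite (eq_sym z) (negPf h).
move: U U'; rewrite /= !inE !negb_or !andbT.
move=> /and3P [/and3P [ij ik _] /andP [jk _] _] /and3P [/and3P [_ ik' _] /andP [jk' _] _].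
have E := (S _ _ mi, S _ _ mj, S _ _ mk, S _ _ mk', S _ _ kk', S _ _ ij, S _ _ ik,
  S _ _ jk, S _ _ ik', S _ _ jk').
have [f Gf] : exists d, G (mon d (cyc j k k')).
  by apply/G_lift/even_cyc; rewrite /= !inE !E.
have f0 z := lift_neq0 z Gf.
have := lift_prod Gf Gd'; rewrite -cyc_third; last by rewrite /= !inE !E.
move=> /(lift_ratio Gd) /(diag_part_ratio i m).
rewrite !cyc_fix /= ?inE ?E // => Xr.
have Xf : ratio_group (f i / f m) by apply: (fix_ratio _ _ Gf); rewrite /= !inE !E.
have := ratio_groupM Xr Xf.
congr (ratio_group _); field.
by rewrite !(d0, d'0, f0, oner_eq0).
Qed.

(** The cube of the lift is diagonal, with the product of the three entries at [i] and a cube at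
    [l]. This determines the entry at [k] from those at [i] and [j]. *)
Lemma lift_cube i j k l d : uniq [:: i; j; k; l] -> G (mon d (cyc i j k)) ->
  ratio_group (d i * d j * d k / d l ^+ 3).
Proof.
move=> U Gd; have d0 z := lift_neq0 z Gd.
have U3 : uniq [:: i; j; k] := subseq_uniq (prefix_subseq [:: i; j; k] [:: l]) U.
have c3 : (cyc i j k * cyc i j k * cyc i j k)%g = 1%g.
  apply/permP => z; rewrite !permM perm1.
  have [->|zi] := eqVneq z i; first by rewrite cyc_1 // cyc_2 // cyc_3.
  have [->|zj] := eqVneq z j; first by rewrite cyc_2 // cyc_3 // cyc_1.
  have [->|zk] := eqVneq z k; first by rewrite cyc_3 // cyc_1 // cyc_2.
  by rewrite !(cycE _ U3) (negPf zi) (negPf zj) (negPf zk) !(negPf zi, negPf zj, negPf zk).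
have := lift_prod (lift_prod Gd Gd) Gd; rewrite c3 => /(diag_part_ratio i l).
rewrite !permM !(cyc_fix U) !(cyc_1 U3) !(cyc_2 U3).
congr (ratio_group _); field.
by rewrite !d0.
Qed.

(* E is built so that the entry of a lift of a 3-cycle at a point moved from i
   to i+1 becomes, modulo ratio_group, its entry at the fixed points. *)
Lemma normalizing_diag : exists2 E : 'I_p -> F, (forall i, E i != 0) &
  forall t, ~~ odd_perm t -> exists2 d, (forall i j, ratio_group (d i / d j)) &
    G (mon (fun i => d i * (E (t i) / E i)) t).
Proof.
have [al Hal] : exists al, forall i, al i != 0 /\
    forall j, j = i.+1 :> nat -> normalized_entry i j (al i).
  apply: (@fin_all_exists _ (fun=> F) (fun i c => c != 0 /\
    forall j, j = i.+1 :> nat -> normalized_entry i j c)) => i.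
  case: (ltnP i.+1 p) => ip; last first.
    (* The last index has no successor; any nonzero value would do. *)
    exists 1; split; first exact: oner_neq0.
    by move=> j ji; have := ltn_ord j; rewrite ji ltnNge ip.
  have [|c Rc] := @normalized_entry_exists i (Ordinal ip); first by rewrite -val_eqE /=; lia.
  exists c; split; last by move=> j ji; have -> : j = Ordinal ip by apply: val_inj.
  have [k [l [d [_ Gd ->]]]] := Rc.
  by rewrite mulf_neq0 ?invr_eq0 ?(lift_neq0 _ Gd).
(* Partial products, so that [E] grows by the factor [al i] from i to i+1. *)
pose E (z : 'I_p) := \prod_(i < p | (i < z)%N) al i.
have E0 z : E z != 0 by apply/prodf_neq0 => i _; have [] := Hal i.
have ES i j : j = i.+1 :> nat -> E j = E i * al i.
  move=> ji; rewrite /E (bigD1 i) /= ?ji // mulrC; congr (_ * _).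
  by apply: eq_bigl => k; rewrite -val_eqE /=; lia.
exists E => //; apply: even_perm_ind.
- exists (fun=> 1) => [i j|]; first by rewrite divr1; apply: ratio_group1.
  apply: diag_part_ext diag_part1 => i; rewrite perm1 divff // mulr1 //.
- move=> t u [d Xd Gd] [e Xe Ge].
  exists (fun i => d i * e (t i)) => [i j|].
    by rewrite invfM mulrACA; apply: ratio_groupM.
  have := lift_prod Gd Ge; congr (G _); apply: mon_ext => i.
  by rewrite permM; field; rewrite !E0.
move=> i j k ji ki.
have [l] := @exists_notin p [:: i; j; k] ltac:(rewrite /=; lia).
rewrite !inE !negb_or => /and3P [li lj lk].
have U : uniq [:: i; j; k; l].
  by move: li lj lk; rewrite /= !inE -!val_eqE /=; lia.
have U3 : uniq [:: i; j; k] := subseq_uniq (prefix_subseq [:: i; j; k] [:: l]) U.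
have [d Gd] := G_lift (even_cyc U3); have d0 z := lift_neq0 z Gd.
pose t := cyc i j k; pose d' z := d z * E z / E (t z).
exists d'; last first.
  by congr (G _): Gd; apply: mon_ext => z; rewrite /d' /t; field; rewrite !E0.
suff Xl z : ratio_group (d' z / d l).
  move=> y z; have := ratio_group_div (Xl y) (Xl z).
  congr (ratio_group _); field.
  by rewrite d0 /d' !mulf_neq0 ?invr_eq0.
have kj : k = j.+1 :> nat by rewrite ji.
have [[ali Ri] [alj Rj]] := (Hal i, Hal j).
have Xi : ratio_group (d i / d l / al i).
  by apply: normalized_entry_unique (Ri j ji); exists k, l, d.
have Xj : ratio_group (d j / d l / al j).
  apply: normalized_entry_unique (Rj k kj); exists i, l, d; split => //; last by rewrite -cyc_rot.
  by move: U; rewrite /= !inE -!val_eqE /=; lia.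
rewrite /d' /t.
have [->|zi] := eqVneq z i.
  rewrite cyc_1 // (ES i j ji).
  by congr (ratio_group _): Xi; field; rewrite !E0 d0 ali.
have [->|zj] := eqVneq z j.
  rewrite cyc_2 // (ES j k kj).
  by congr (ratio_group _): Xj; field; rewrite !E0 d0 alj.
have [->|zk] := eqVneq z k.
  (* Going from [k] back to [i] divides [E] by both [al i] and [al j]; [lift_cube] absorbs these
     factors. *)
  rewrite cyc_3 // (ES j k kj) (ES i j ji).
  have := ratio_group_div (ratio_group_div (lift_cube U Gd) Xi) Xj.
  by congr (ratio_group _); field; rewrite !E0 !d0 ali alj.
have Uz : uniq [:: i; j; k; z].
  move: U; rewrite /= !inE !negb_or !(eq_sym _ z) zi zj zk !andbT.
  by case/and3P => /and3P [-> -> _] /andP [-> _] _.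
rewrite cyc_fix // mulfK //; exact: fix_ratio U Gd.
Qed.

(* A commutator of normalized lifts differs from a permutation matrix by a
   diagonal matrix with entries in the group of ratios and determinant 1. *)
Lemma twisted_alternating : exists2 E : 'I_p -> F, (forall i, E i != 0) &
  forall t, ~~ odd_perm t -> G (mon (fun i => E (t i) / E i) t).
Proof.
have [E E0 lift] := normalizing_diag; exists E => //.
apply: even_perm_ind.
- by apply: diag_part_ext diag_part1 => i; rewrite perm1 divff.
- move=> t u Gt Gu; have := lift_prod Gt Gu; congr (G _); apply: mon_ext => i.
  by rewrite permM; field; rewrite !E0.
move=> a b c ba ca.
have [f] := @exists_notin p [:: a; b; c] ltac:(rewrite /=; lia).
have [e] := @exists_notin p [:: a; b; c; f] ltac:(rewrite /=; lia).
move=> He Hf; have U : uniq [:: a; b; c; f; e].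
  by move: He Hf; rewrite /= !inE -!val_eqE /=; lia.
have Uu : uniq [:: a; c; f] by move: U; rewrite /= !inE -!val_eqE /=; lia.
have Uv : uniq [:: a; b; e] by move: U; rewrite /= !inE -!val_eqE /=; lia.
set t := cyc a b c; have tE := cyc_comm U; rewrite -/t in tE.
have [du Xu Gu] := lift _ (even_cyc Uu); have [dv Xv Gv] := lift _ (even_cyc Uv).
move: (cyc a c f) (cyc a b e) tE Gu Gv => u v tE Gu Gv {Uu Uv}.
have nz (d : 'I_p -> F) i : (forall i j, ratio_group (d i / d j)) -> d i != 0.
  by move=> Xd; have /ratio_group_neq0 := Xd i i; rewrite mulf_eq0 negb_or => /andP [].
have du0 i := nz _ i Xu; have dv0 i := nz _ i Xv.
(* This is the defect of the commutator; its determinant is 1 because reindexing by [u] and [v]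
   preserves products over all points. *)
have Dy : diag_part (fun i => du i / du (v i) * (dv (u i) / dv i)).
  apply: diag_part_of_prod1 => [i|]; first exact: ratio_groupM.
  rewrite !big_split /= !prodfV.
  rewrite -(reindex_inj (@perm_inj _ v) (P := xpredT) (F := du)).
  rewrite -(reindex_inj (@perm_inj _ u) (P := xpredT) (F := dv)).
  by rewrite !divff ?mulr1 //; apply/prodf_neq0 => i _; [apply: dv0 | apply: du0].
have Gvu := lift_prod Gv Gu.
have := GM (GV Gvu) (GM (GV Dy) (lift_prod Gu Gv)).
congr (G _); rewrite tE.
set P := mon _ (v * u)%g; set Q := mon _ t.
suff -> : invmx (mon (fun i => du i / du (v i) * (dv (u i) / dv i)) 1%g) *m
   mon (fun i => du i * (E (u i) / E i) * (dv (u i) * (E (v (u i)) / E (u i)))) (v * u * t)%g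
   = P *m Q by rewrite mulKmx //; apply: GU.
rewrite -[RHS](mulKmx (GU Dy)) monM monM; congr (_ *m _); rewrite mul1g.
apply: mon_ext => i; rewrite perm1 -!permM -tE !permM; field.
by rewrite !(E0, du0, dv0, oner_eq0).
Qed.

End AlternatingPermutationPart.

(** * The groups generated by [s], [w] and an admissible diagonal group *)

Section AlternatingExtensions.
Variables (F : fieldType) (p : nat) (p_gt6 : (6 < p)%N) (p_odd : odd p).
Implicit Types (A B H : mxset F p) (x y d : 'I_p -> F) (t u : 'S_p) (i j k : 'I_p).

Lemma nat_perm_mxE (f : nat -> nat) t : (forall i, t i = f i :> nat) ->
  nat_perm_mx F p f = perm_mx t.
Proof. by move=> tf; apply/matrixP => i j; rewrite !mxE -val_eqE /= tf eq_sym. Qed.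

Definition cyclic_shift : 'S_p := perm (@ordS_inj p).

Lemma s_mxE : s_mx F p = perm_mx cyclic_shift.
Proof. by apply: nat_perm_mxE => i; rewrite permE. Qed.

Lemma w_mxE i j k : i = 0%N :> nat -> j = 1%N :> nat -> k = 2%N :> nat ->
  w_mx F p = perm_mx (cyc i j k).
Proof.
move=> i0 j1 k2; apply: nat_perm_mxE => z.
rewrite cycE /= ?inE -?val_eqE /= ?i0 ?j1 ?k2 //.
by do 3?case: ifP.
Qed.

(** The shift has order dividing the odd number [p], so its sign is 1. *)
Lemma even_cyclic_shift : ~~ odd_perm cyclic_shift.
Proof.
set s := cyclic_shift.
have sX n i : ((s ^+ n)%g i = (i + n) %% p :> nat)%N.
  elim: n => [|n IH]; first by rewrite perm1 addn0 modn_small.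
  by rewrite expgSr permM permE /= IH -addn1 modnDml addn1 addnS.
have sp : (s ^+ p)%g = 1%g.
  by apply/permP => i; apply: val_inj; rewrite /= sX perm1 /= modnDr modn_small.
have oX n : odd_perm (s ^+ n)%g = odd n && odd_perm s.
  by elim: n => [|n IH]; rewrite ?odd_perm1 // expgS odd_permM IH /=; case: odd; case: odd_perm.
by have := oX p; rewrite sp odd_perm1 p_odd /= => <-.
Qed.

(** Conjugating [w] repeatedly by [s] yields all 3-cycles of consecutive points, which generate
    Alt(p). *)
Lemma even_perm_mx_sub H : is_subgroup H -> H (s_mx F p) -> H (w_mx F p) ->
  forall t, ~~ odd_perm t -> H (perm_mx t).
Proof.
move=> [H1 HU HM HV] Hs Hw.
have perm_mxM t u : H (perm_mx t) -> H (perm_mx u) -> H (perm_mx (t * u)%g).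
  by move=> Ht Hu; rewrite perm_mxM; apply: HM.
have perm_mxV t : H (perm_mx t) -> H (perm_mx t^-1%g).
  move=> /HV; rewrite !perm_mxE invmx_mon => [|i]; last exact: oner_neq0.
  by congr (H _); apply: mon_ext => i; rewrite invr1.
apply: even_perm_ind => //; first by rewrite perm_mx1.
suff step n : forall i j k, i = n :> nat -> j = n.+1 :> nat -> k = n.+2 :> nat ->
    H (perm_mx (cyc i j k)).
  by move=> i j k ji ki; apply: (step i).
elim: n => [|n IH] i j k iE jE kE.
  by rewrite -w_mxE.
have lt0 : (n < p)%N by rewrite -iE ltnW // iE -jE ltnW // jE -kE.
have lt1 : (n.+1 < p)%N by rewrite -iE.
have lt2 : (n.+2 < p)%N by rewrite -jE.
have := IH (Ordinal lt0) (Ordinal lt1) (Ordinal lt2) erefl erefl erefl.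
have Hsp : H (perm_mx cyclic_shift) by rewrite -s_mxE.
move=> Hc; have := perm_mxM _ _ (perm_mxV _ Hsp) (perm_mxM _ _ Hc Hsp).
rewrite -/(conjg _ _) cycJ; congr (H (perm_mx (cyc _ _ _)));
  by apply: val_inj; rewrite permE /= modn_small ?iE ?jE ?kE // -kE.
Qed.

(** The product set A Alt(p), an explicit form of the generated group, as [swAE] shows. *)
Definition alt_ext A g := exists2 t, ~~ odd_perm t &
  exists2 x, A (mon x 1%g) & g = mon x t.

Lemma admissible_diagP A g : admissible_diag A -> A g ->
  exists2 x, (forall i, x i != 0) & g = mon x 1%g.
Proof. by case=> _ _ /(_ g) Ad _ _ /Ad /is_diag_invP. Qed.

Lemma admissible_neq0 A x i : admissible_diag A -> A (mon x 1%g) -> x i != 0.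
Proof. by case=> [[_ AU _ _] _ _ _ _] /AU /mon_unit. Qed.

Lemma admissible_conj A x t : admissible_diag A -> A (mon x 1%g) ->
  A (mon (x \o t) 1%g).
Proof.
case=> _ _ _ Aconj _ Ax; apply/(Aconj t^-1%g); exists (mon x 1%g) => //.
rewrite perm_mxE invmx_mon => [|i]; last exact: oner_neq0.
rewrite !monM mulg1 mulVg; apply: mon_ext => i /=.
by rewrite invgK invr1 mul1r mulr1.
Qed.

(** If two coordinates agreed on all of [A], invariance under the transpositions (j k) would make
    all coordinates agree, and [A] would be scalar. *)
Lemma admissible_separates A i j : admissible_diag A -> i != j ->
  exists2 x, A (mon x 1%g) & x i != x j.
Proof.
move=> adA ij; apply: boolp.contrapT => nsep.
have eqA x : A (mon x 1%g) -> x i = x j.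
  by move=> Ax; apply/eqP; apply: contraT => nx; case: nsep; exists x.
case: (adA) => _ _ _ _; apply => g Ag; have [x _ gE] := admissible_diagP adA Ag.
exists (x i); rewrite gE -mon_scalar; apply: mon_ext => k.
rewrite gE in Ag; have [->|ki] := eqVneq k i; first by [].
have := eqA _ (admissible_conj (tperm j k) adA Ag).
by rewrite /= tpermL tpermD // eq_sym.
Qed.

Lemma alt_ext_subgroup A : admissible_diag A -> is_subgroup (alt_ext A).
Proof.
move=> adA; have [[A1 AU AM AV] _ _ _ _] := adA; split.
- by exists 1%g; rewrite ?odd_perm1 //; exists (fun=> 1); rewrite mon1.
- by move=> g [t _ [x Ax ->]]; apply/mon_unit => i; apply: admissible_neq0 Ax.
- move=> g h [t et [x Ax ->]] [u eu [y Ay ->]].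
  exists (t * u)%g; first by rewrite odd_permM (negPf et) (negPf eu).
  exists (fun i => x i * y (t i)); last by rewrite monM.
  have := AM _ _ Ax (admissible_conj t adA Ay); rewrite monM mulg1.
  by congr (A _); apply: mon_ext => i; rewrite perm1.
- move=> g [t et [x Ax ->]]; have x0 i := admissible_neq0 i adA Ax.
  exists t^-1%g; first by rewrite odd_permV.
  exists (fun i => (x (t^-1 i)%g)^-1); last by rewrite invmx_mon.
  have := AV _ Ax; rewrite invmx_mon // invg1 => /(admissible_conj t^-1%g adA).
  by congr (A _); apply: mon_ext => i; rewrite /= perm1.
Qed.

Lemma swAE A : admissible_diag A -> forall g, swA A g <-> alt_ext A g.
Proof.
move=> adA; have [[A1 _ _ _] _ _ _ _] := adA; rewrite -mon1 in A1.
have sub_perm t : ~~ odd_perm t -> alt_ext A (perm_mx t).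
  by move=> et; exists t => //; exists (fun=> 1); rewrite ?perm_mxE.
move=> g; split.
  apply; first exact: alt_ext_subgroup.
  move=> h [->|[->|Ah]].
  - by rewrite s_mxE; apply/sub_perm/even_cyclic_shift.
  - have l0 : (0 < p)%N by lia.
    have l1 : (1 < p)%N by lia.
    have l2 : (2 < p)%N by lia.
    pose a := Ordinal l0; pose b := Ordinal l1; pose c := Ordinal l2.
    rewrite (@w_mxE a b c) //.
    by apply/sub_perm/even_cyc.
  - have [x _ hE] := admissible_diagP adA Ah.
    by exists 1%g; rewrite ?odd_perm1 //; exists x; rewrite -?hE.
move=> [t et [x Ax ->]] H HH sub; have [H1 HU HM HV] := HH.
have -> : mon x t = mon x 1%g *m perm_mx t.
  by rewrite perm_mxE monM mul1g; apply: mon_ext => i; rewrite mulr1.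
apply: HM; first by apply: sub; right; right.
by apply: even_perm_mx_sub => //; apply: sub; [left | right; left].
Qed.

Lemma swA_subgroup A : admissible_diag A -> is_subgroup (swA A).
Proof.
move=> adA; have [H1 HU HM HV] := alt_ext_subgroup adA.
have E := swAE adA; split; first exact/E.
- by move=> g /E /HU.
- by move=> g h /E Hg /E Hh; apply/E/HM.
- by move=> g /E Hg; apply/E/HV.
Qed.

Lemma swA_perm A t : admissible_diag A -> ~~ odd_perm t -> swA A (perm_mx t).
Proof.
move=> adA et; apply/(swAE adA); exists t => //; exists (fun=> 1); last by rewrite perm_mxE.
by rewrite mon1; case: adA => [[]].
Qed.

Lemma swA_irreducible A : admissible_diag A -> mx_irreducible_set (swA A).
Proof.
move=> adA U Uinv.
have [U0|/matrix0Pn [k0 [i Uki]]] := eqVneq U 0; first by left; rewrite U0 mxrank0.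
right; have stab (v : 'rV_p) g : (v <= U)%MS -> swA A g -> (v *m g <= U)%MS.
  by move=> vU /Uinv; apply: submx_trans; apply: submxMr.
(* Coordinates are killed one by one: with [x] separating [i] from [j], the vector v x - x_j v
   vanishes at [j] but not at [i]. Eventually a multiple of the [i]-th basis vector lies in [U], and
   even permutations carry it to all others. *)
have sep (r : seq 'I_p) : i \notin r ->
    exists v : 'rV_p, [/\ (v <= U)%MS, v 0 i != 0 & forall j, j \in r -> v 0 j = 0].
  elim: r => [_|j r IH]; first by exists (row k0 U); rewrite row_sub mxE.
  rewrite inE negb_or => /andP [ij /IH [v [vU vi v0]]].
  have [x Ax xij] := admissible_separates adA ij.
  have Sx : swA A (mon x 1%g) by apply/(swAE adA); exists 1%g; rewrite ?odd_perm1 //; exists x.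
  have vE k : (v *m mon x 1%g - x j *: v) 0 k = v 0 k * (x k - x j).
    have := mulmx_monE v x 1%g 0 k; rewrite perm1 => vxk.
    by rewrite [LHS]mxE vxk [X in _ + X]mxE [X in - X]mxE; ring.
  exists (v *m mon x 1%g - x j *: v); split.
  - by rewrite addmx_sub ?stab // -scaleNr scalemx_sub.
  - by rewrite vE mulf_neq0 // subr_eq0.
  - by move=> k; rewrite inE vE => /orP [/eqP -> | /v0 ->]; rewrite ?subrr ?mulr0 ?mul0r.
have [|v [vU vi v0]] := sep (rem i (enum 'I_p)).
  by rewrite mem_rem_uniq ?enum_uniq // inE eqxx.
have {}v0 j : j != i -> v 0 j = 0.
  by move=> ji; apply: v0; rewrite mem_rem_uniq ?enum_uniq // inE ji mem_enum.
apply/eqP; rewrite eqn_leq rank_leq_row -{1}(mxrank1 F p) mxrankS //.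
apply/row_subP => k.
have [j ij] := @exists_notin p [:: i] ltac:(rewrite /=; lia).
have [l kl] := @exists_notin p [:: k] ltac:(rewrite /=; lia).
rewrite !inE in ij kl.
rewrite eq_sym in ij; rewrite eq_sym in kl.
have [t [et tik _]] := even_perm2 (ltac:(lia) : (3 < p)%N) kl ij.
have -> : row k 1%:M = (v 0 i)^-1 *: (v *m perm_mx t).
  apply/rowP => z; rewrite perm_mxE -(permKV t z) mxE [RHS]mxE mulmx_monE mulr1 !mxE.
  rewrite -tik (inj_eq perm_inj); have [<-|zi] := eqVneq i (t^-1 z)%g; first by rewrite mulVf.
  by rewrite (v0 (t^-1 z)%g) ?mulr0 // eq_sym.
by apply: scalemx_sub; apply: stab => //; apply: swA_perm.
Qed.

Lemma swA_fin_irr A : admissible_diag A -> fin_irr_monomial_group (swA A).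
Proof.
move=> adA; split; [exact: swA_subgroup | | | exact: swA_irreducible].
  have [_ [r Ar] _ _ _] := adA.
  exists [seq g *m perm_mx t | g <- r, t <- enum 'S_p] => g /(swAE adA) [t _ [x Ax ->]].
  apply/allpairsP; exists (mon x 1%g, t); split => /=; [exact: Ar | by rewrite mem_enum |].
  by rewrite perm_mxE monM mul1g; apply: mon_ext => i; rewrite mulr1.
move=> g /(swAE adA) [t _ [x Ax ->]]; exists t; apply/monomial_with_permP.
by exists x => // i; apply: admissible_neq0 Ax.
Qed.

Lemma swA_perm_part A t : admissible_diag A -> perm_part (swA A) t <-> ~~ odd_perm t.
Proof.
move=> adA; split=> [[g Sg /monomial_with_permP [d d0 gE]] | et].
  move: Sg; rewrite gE => /(swAE adA) [u eu [x _]] /(mon_inj d0) [-> _] //.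
exists (perm_mx t); first exact: swA_perm.
apply/monomial_with_permP; exists (fun=> 1); last exact: perm_mxE.
by move=> i; apply: oner_neq0.
Qed.

(** * Every group with permutation part Alt(p) is conjugate to a standard one *)

Lemma fin_irr_alt_conjugate (G : mxset F p) : fin_irr_monomial_group G ->
  (forall t, perm_part G t <-> ~~ odd_perm t) ->
  exists2 A, admissible_diag A & GL_conjugate G (swA A).
Proof.
move=> [Gsub [r Gr] Gmon Girr] Galt; have [G1 GU GM GV] := Gsub.
have lift t : ~~ odd_perm t -> exists d, G (mon d t).
  by move=> /Galt [g Gg /monomial_with_permP [d _ gE]]; exists d; rewrite -gE.
have [E E0 GE] := twisted_alternating p_gt6 Gsub lift.
have GP g : G g -> exists2 t, ~~ odd_perm t &
    exists2 x, G (mon x 1%g) & g = mon x 1%g *m mon (fun i => E (t i) / E i) t.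
  move=> Gg; have [t /monomial_with_permP [d d0 gE]] := Gmon g Gg.
  have et : ~~ odd_perm t by apply/Galt; exists g => //; apply/monomial_with_permP; exists d.
  exists t => //; exists (fun i => d i / (E (t i) / E i)).
    by apply: (@lift_ratio _ _ G Gsub _ _ t); [rewrite -gE | apply: GE].
  rewrite monM mul1g gE; apply: mon_ext => i; rewrite perm1 divfK //.
  by rewrite mulf_neq0 ?invr_eq0.
pose A g := G g /\ is_diag_inv g.
have AP x : A (mon x 1%g) <-> G (mon x 1%g).
  split=> [[] //|Gx]; split => //; apply/is_diag_invP; exists x => // i.
  exact: lift_neq0 Gsub _ _ _ Gx.
have adA : admissible_diag A.
  split.
  - split; first by rewrite -mon1; apply/AP; rewrite mon1.
    + by move=> g [/GU].
    + move=> g h [Gg /is_diag_invP [x x0 gE]] [Gh /is_diag_invP [y y0 hE]].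
      have := GM _ _ Gg Gh; rewrite gE hE monM mulg1 => Gxy; exact/AP.
    + move=> g [Gg /is_diag_invP [x x0 gE]].
      have := GV _ Gg; rewrite gE invmx_mon // invg1 => Gx; exact/AP.
  - by exists r => g [/Gr].
  - by move=> g [].
  - have conjE t x : invmx (perm_mx t) *m mon x 1%g *m perm_mx t = mon (x \o t^-1%g) 1%g.
      rewrite perm_mxE invmx_mon => [|i]; last exact: oner_neq0.
      rewrite !monM mulg1 mulVg; apply: mon_ext => i /=.
      by rewrite invr1 mul1r mulr1.
    move=> t g; split.
      move=> [h [Gh /is_diag_invP [x _ hE]] ->]; rewrite hE conjE; apply/AP.
      by apply: (diag_part_conj_all p_gt6 Gsub lift); rewrite /diag_part -hE.
    move=> [Gg /is_diag_invP [x x0 gE]]; exists (mon (x \o t) 1%g).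
      by apply/AP/(diag_part_conj_all p_gt6 Gsub lift); rewrite /diag_part -gE.
    by rewrite conjE gE; apply: mon_ext => i /=; rewrite permKV.
  (* All rows of [U] equal [E], which the twisted copy of Alt(p) fixes; if [A] were scalar, this
     line would be invariant. *)
  move=> Asc; pose U := (const_mx 1 : 'cV_p) *m \row_j E j.
  have [|rU|rU] := Girr U.
  - move=> g /GP [t et [x Gx ->]]; have [|c xc] := Asc (mon x 1%g); first exact/AP.
    rewrite xc mul_scalar_mx -scalemxAr scalemx_sub // /U -mulmxA.
    suff -> : (\row_j E j) *m mon (fun i => E (t i) / E i) t = \row_j E j by [].
    apply/rowP => z; rewrite -(permKV t z) mulmx_monE !mxE permKV.
    by rewrite mulrC divfK.
  - have [o _] := @exists_notin p [::] ltac:(rewrite /=; lia).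
    have := E0 o; have /eqP := rU; rewrite mxrank_eq0 => /eqP /matrixP /(_ o o).
    by rewrite mxE big_ord1 !mxE mul1r => ->; rewrite eqxx.
  - have : (\rank U <= 1)%N by apply: mulmx_max_rank.
    rewrite rU; lia.
(* Conjugation by the inverse of [E] untwists the copy of Alt(p) and centralizes [A]. *)
exists A => //; pose E' i := (E i)^-1.
have E'0 i : E' i != 0 by rewrite invr_eq0.
exists (mon E' 1%g); first exact/mon_unit.
have conjE x t : invmx (mon E' 1%g) *m (mon x 1%g *m mon (fun i => E (t i) / E i) t)
    *m mon E' 1%g = mon x t.
  rewrite invmx_mon // !monM !mulg1 invg1 !mul1g; apply: mon_ext => i.
  by rewrite /E' !perm1; field; rewrite !E0 oner_eq0.
move=> h; split.
  move=> [g /GP [t et [x Gx ->]] ->]; rewrite conjE; apply/(swAE adA).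
  by exists t => //; exists x => //; apply/AP.
move=> /(swAE adA) [t et [x /AP Gx ->]].
exists (mon x 1%g *m mon (fun i => E (t i) / E i) t); last by rewrite conjE.
exact: GM Gx (GE _ et).
Qed.

(** * Distinct standard groups are not conjugate *)

Lemma GL_conjugate_sym (G H : mxset F p) : GL_conjugate G H -> GL_conjugate H G.
Proof.
move=> [P UP GH]; exists (invmx P); first by rewrite unitmx_inv.
move=> g; rewrite /conj_set invmxK; split.
  move=> [h /GH [k Gk ->] ->].
  by rewrite !mulmxA mulmxV // mul1mx -mulmxA mulmxV // mulmx1.
move=> Gg; exists (invmx P *m g *m P); first by apply/GH; exists g.
by rewrite !mulmxA mulmxV // mul1mx -mulmxA mulmxV // mulmx1.
Qed.

(* The image of B in the permutation part is an abelian normal subgroup of the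
   alternating group, hence trivial. *)
Lemma conjugate_diag A B (P : 'M[F]_p) y : admissible_diag A -> admissible_diag B ->
  P \in unitmx -> set_eq (conj_set P (swA A)) (swA B) -> B (mon y 1%g) ->
  exists2 x, A (mon x 1%g) & forall i j, P i j * y j = x i * P i j.
Proof.
move=> adA adB UP AB By.
have [g Sg yE] : conj_set P (swA A) (mon y 1%g).
  by apply/AB/(swAE adB); exists 1%g; rewrite ?odd_perm1 //; exists y.
have [t et [x Ax gE]] := (swAE adA g).1 Sg.
have x0 i := admissible_neq0 i adA Ax.
pose f (h : 'M[F]_p) := invmx P *m h *m P.
have fM (h h' : 'M_p) : f (h *m h') = f h *m f h'.
  by rewrite /f !mulmxA; congr (_ *m _ *m _); rewrite -[RHS]mulmxA mulmxV // mulmx1.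
have f_inj : injective f.
  by move=> h h' /(can_inj (mulmxK UP)) /(can_inj (mulKVmx UP)).
have t1 : t = 1%g.
  apply: commuting_conjugates_id => [|a b c abc]; first by lia.
  move: (cyc a b c) (even_cyc abc) => u eu.
  have [v ev [e Be mE]] : alt_ext B (f (perm_mx u)).
    by apply/(swAE adB)/AB; exists (perm_mx u) => //; apply: swA_perm.
  have e0 i := admissible_neq0 i adB Be.
  (* [g'] is the conjugate of [g] by the permutation matrix of [u], and [D] is its image under [f].
     Diagonal matrices commute, so [g] and [g'] do, and so do [t] and [t ^ u]. *)
  pose D := mon (y \o v^-1%g) 1%g; pose g' := mon (x \o u^-1%g) (t ^ u)%g.
  have mD : mon e v *m D = mon y 1%g *m mon e v.
    by rewrite !monM mulg1 mul1g; apply: mon_ext => i /=; rewrite permK perm1 mulrC.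
  have Pg' : perm_mx u *m g' = g *m perm_mx u.
    rewrite perm_mxE gE !monM -conjgC; apply: mon_ext => i /=.
    by rewrite permK mulrC.
  have fg' : f g' = D.
    have Um : mon e v \in unitmx by apply/mon_unit.
    apply: (can_inj (mulKmx Um)); rewrite mD -mE -fM Pg' fM yE //.
  have : g *m g' = g' *m g.
    have fg : f g = mon y 1%g by [].
    apply: f_inj; rewrite !fM fg' fg /D !monM; apply: mon_ext => i.
    by rewrite !perm1 mulrC.
  rewrite gE !monM => E; have [i | tC _] := mon_inj _ E; last exact: tC.
  by rewrite mulf_neq0 /=.
exists x => // i j; have : P *m mon y 1%g = mon x 1%g *m P.
  by rewrite yE gE t1 !mulmxA mulmxV // mul1mx.
by move=> /matrixP /(_ i j); rewrite -{1}(perm1 j) mulmx_monE mon_mulmxE perm1.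
Qed.

(** Two nonzero entries in a row of [P] would equate two coordinates on all of [B], so [P] is
    monomial. Each [y] from [B] is then a rearrangement of some [x] from [A], and [A] is invariant
    under Sym(p). *)
Lemma swA_conjugate_sub A B : admissible_diag A -> admissible_diag B ->
  GL_conjugate (swA A) (swA B) -> set_sub B A.
Proof.
move=> adA adB [P UP AB] g Bg.
have row1 i j j' : P i j != 0 -> P i j' != 0 -> j = j'.
  move=> Pj Pj'; apply/eqP; apply: contraT => jj'.
  have [y By] := admissible_separates adB jj'.
  have [x _ xy] := conjugate_diag adA adB UP AB By.
  rewrite (mulfI Pj (etrans (xy i j) (mulrC _ _))).
  by rewrite (mulfI Pj' (etrans (xy i j') (mulrC _ _))) eqxx.
have [f fP] : exists f : 'I_p -> 'I_p, forall j, P (f j) j != 0.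
  apply: fin_all_exists (fun j i => P i j != 0) _ => j.
  apply/existsP; apply: contraT => /existsPn Pj.
  have := mulVmx UP => /matrixP /(_ j j); rewrite !mxE eqxx big1 => [/eqP|k _].
    by rewrite eq_sym oner_eq0.
  by have := Pj k; rewrite negbK => /eqP ->; rewrite mulr0.
have f_inj : injective f.
  by move=> j j' ff; apply: (row1 (f j)); rewrite // ff.
have [y _ gE] := admissible_diagP adB Bg; rewrite gE in Bg *.
have [x Ax xy] := conjugate_diag adA adB UP AB Bg.
have := admissible_conj (perm f_inj) adA Ax; congr (A _); apply: mon_ext => j /=.
by rewrite permE (mulfI (fP j) (etrans (xy (f j) j) (mulrC _ _))).
Qed.

Lemma swA_mono A B : set_sub A B -> set_sub (swA A) (swA B).
Proof.
move=> AB g gA H HH HS; apply: gA => // h [hs|[hw|/AB hB]]; apply: HS; auto.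
Qed.

End AlternatingExtensions.

Local Open Scope complex_scope.
Theorem theorem8p7 (R : realType) (p : nat) (p_prime : prime p) (p_ge7 : (7 <= p)%N) :
  (* each <s,w,A> is a finite irreducible subgroup of M(p,C) with
     permutation part Alt(p) *)
  (forall A : mxset R[i] p, admissible_diag A ->
     fin_irr_monomial_group (swA A) /\
     (forall a : 'S_p, perm_part (swA A) a <-> ~~ odd_perm a)) /\
  (* every such group is GL(p,C)-conjugate to one of them *)
  (forall G : mxset R[i] p, fin_irr_monomial_group G ->
     (forall a : 'S_p, perm_part G a <-> ~~ odd_perm a) ->
     exists2 A : mxset R[i] p, admissible_diag A & GL_conjugate G (swA A)) /\
  (* no two distinct ones are GL(p,C)-conjugate *)
  (forall A B : mxset R[i] p, admissible_diag A -> admissible_diag B ->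
     GL_conjugate (swA A) (swA B) -> set_eq (swA A) (swA B)).
Proof.
have p_odd : odd p by case: (even_prime p_prime) => // p2; rewrite p2 in p_ge7.
split=> [A adA|]; first by split=> [|a]; [apply: swA_fin_irr | apply: swA_perm_part].
split=> [G|A B adA adB AB g]; first exact: fin_irr_alt_conjugate.
split; apply: swA_mono.
  by apply: (swA_conjugate_sub p_ge7 p_odd adB adA); apply: GL_conjugate_sym.
exact: (swA_conjugate_sub p_ge7 p_odd adA adB).
Qed.
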